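(* Let $A$ be any set. For every $s\in\mathbb N$ and every set of operations $F\subseteq O_A$ we have $$\mathrm{Polp}\,\mathrm{Invp}^{(\le s)}F = s\text{-}\mathrm{Loc}\,\langle F\rangle_{\mathrm S}.$$
   Context: $A$ is an arbitrary set (possibly empty, finite or infinite). $\mathbb N=\{0,1,2,\dots\}$, $n=\{0,\dots,n-1\}$ for $n\in\mathbb N$, and $A^n$ is the set of maps $n\to A$ (so $A^0=\{\emptyset\}$). $O_A^{(n)}=A^{A^n}$ is the set of $n$-ary operations, and $O_A=\biguplus_{n\in\mathbb N}O_A^{(n)}$ is the set of all finitary operations (nullary ones included); for $F\subseteq O_A$ put $F^{(n)}=F\cap O_A^{(n)}$. For $n\ge1$ and $i<n$, $e^{(n)}_i\in O_A^{(n)}$ is the $i$-th projection; $J_A$ is the set of all projections. For $f\in O_A^{(n)}$ and $g_0,\dots,g_{n-1}\in O_A^{(m)}$ the composition $f\circ(g_0,\dots,g_{n-1})\in O_A^{(m)}$ maps $x$ to $f(g_0(x),\dots,g_{n-1}(x))$; for $n=0$ it is the $m$-ary constant operation with the value of $f$. A semiclone on $A$ is a set $F\subseteq O_A$ such that for all $m,n\in\mathbb N$, $f\in F^{(n)}$ and $g_0,\dots,g_{n-1}\in(F\cup J_A)^{(m)}$ we have $f\circ(g_0,\dots,g_{n-1})\in F$. $\langle F\rangle_{\mathrm S}$ is the least semiclone containing $F$. An $m$-ary relation pair ($m\in\mathbb N$) is a pair $(\rho,\rho')$ with $\rho'\subseteq\rho\subseteq A^m$; $\mathrm{Rp}_A^{(m)}$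 is the set of these, and $\mathrm{Rp}_A=\biguplus_{m\in\mathbb N}\mathrm{Rp}_A^{(m)}$ (disjoint union over arities). An operation $f\in O_A^{(n)}$ preserves $(\rho,\rho')\in \mathrm{Rp}_A^{(m)}$ if for all $r_0,\dots,r_{n-1}\in\rho$ the $m$-tuple $\big(f(r_0(i),\dots,r_{n-1}(i))\big)_{i<m}$ belongs to $\rho'$. For $F\subseteq O_A$, $\mathrm{Invp}F$ is the set of all relation pairs in $\mathrm{Rp}_A$ preserved by every $f\in F$, and $\mathrm{Invp}^{(\le s)}F$ is its subset of pairs of arity at most $s$. For $Q\subseteq\mathrm{Rp}_A$, $\mathrm{Polp}\,Q$ is the set of all $f\in O_A$ preserving every pair in $Q$. For $s\in\mathbb N$, $s\text{-}\mathrm{Loc}\,F=\biguplus_{n\in\mathbb N}\{g\in O_A^{(n)} : \forall B\subseteq A^n\text{ with }|B|\le s\ \exists f\in F^{(n)}:\ g|_B=f|_B\}$. *)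

(* Defs.v *)
From mathcomp Require Import all_boot.
From mathcomp Require Import boolp classical_sets functions cardinality.

Set Implicit Arguments.
Unset Strict Implicit.
Unset Printing Implicit Defensive.

Local Open Scope classical_set_scope.
Local Open Scope card_scope.

Section RelationPairs.

Variable A : Type.

(* [op n] is O_A^(n); n-tuples over A are maps ['I_n -> A], so that the unique
   0-tuple exists even when A is empty. *)
Definition op (n : nat) : Type := ('I_n -> A) -> A.

(* O_A; the union over arities is disjoint even when A is empty, where all
   operations of positive arity have the same (empty) graph. *)
Definition ops : Type := {n : nat & op n}.

Definition arity_part (F : set ops) (n : nat) : set (op n) :=
  [set f | F (Tagged op f)].

Definition proj (n : nat) (i : 'I_n) : op n := fun x => x i.

(* Nullary projections are excluded automatically, since ['I_0] is empty. *)
Definition projections : set ops :=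
  [set f | exists (n : nat) (i : 'I_n), f = Tagged op (proj i)].

Definition comp_op (n m : nat) (f : op n) (g : 'I_n -> op m) : op m :=
  fun x => f (fun i => g i x).

Definition semiclone (F : set ops) : Prop :=
  forall (m n : nat) (f : op n) (g : 'I_n -> op m),
    arity_part F f ->
    (forall i, arity_part (F `|` projections) (g i)) ->
    arity_part F (comp_op f g).

Definition semiclone_gen (F : set ops) : set ops := smallest semiclone F.

Record rel_pair (m : nat) : Type := RelPair {
  rp_fst : set ('I_m -> A);
  rp_snd : set ('I_m -> A);
  rp_sub : rp_snd `<=` rp_fst
}.

Definition rel_pairs : Type := {m : nat & rel_pair m}.

Definition preserves (n m : nat) (f : op n) (p : rel_pair m) : Prop :=
  forall r : 'I_n -> ('I_m -> A),
    (forall j, rp_fst p (r j)) -> rp_snd p (fun i => f (fun j => r j i)).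

Definition Invp (F : set ops) : set rel_pairs :=
  [set p | forall f, F f -> preserves (tagged f) (tagged p)].

Definition Invp_le (s : nat) (F : set ops) : set rel_pairs :=
  Invp F `&` [set p | (tag p <= s)%N].

Definition Polp (Q : set rel_pairs) : set ops :=
  [set f | forall p, Q p -> preserves (tagged f) (tagged p)].

Definition sLoc (s : nat) (F : set ops) : set ops :=
  [set g : ops | forall B : set ('I_(tag g) -> A), B #<= `I_s ->
     exists2 f, arity_part F f & forall x, B x -> tagged g x = f x].

End RelationPairs.

(* Main.v *)
Require Import Defs.
From mathcomp Require Import all_boot.
From mathcomp Require Import boolp classical_sets functions cardinality.

(** For the nontrivial inclusion, list a set B of at most s points of A^n as
    b_0, ..., b_(m-1) and consider the relation pair whose members are the
    tuples of values at the b_i of the n-ary operations of the generated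
    semiclone together with the projections, resp. of the semiclone alone. It is
    invariant under F, and an operation g preserving it, applied to the
    projection tuples, yields an operation of the semiclone agreeing with g
    on B. *)

Set Implicit Arguments.
Unset Strict Implicit.
Unset Printing Implicit Defensive.

Local Open Scope classical_set_scope.
Local Open Scope card_scope.

(** An injection of [B] into [I_s] has a finite image [K]; enumerating [K] and choosing preimages
    lists [B]. An empty [B] gives [m = 0], so [T] may be empty. *)
Lemma card_le_II_range (T : Type) (s : nat) (B : set T) :
  B #<= `I_s -> exists2 m, (m <= s)%N & exists b : 'I_m -> T, range b = B.
Proof.
move=> /pcard_leP/injfunPex[f fB f_inj].
pose K := [set k : 'I_s | `[< exists2 x, B x & f x = k >]]%SET.
exists #|K|; first by rewrite -[leqRHS]card_ord max_card.
have /choice[b bP] (j : 'I_#|K|) : exists x, B x /\ f x = enum_val j.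
  by have := enum_valP j; rewrite inE => /asboolP[x]; exists x.
exists b; apply/seteqP; split=> [_ [j _ <-]|x Bx]; first by case: (bP j).
have fxs : (f x < s)%N by exact: fB.
have fxK : Ordinal fxs \in K by rewrite inE; apply/asboolP; exists x.
exists (enum_rank_in fxK (Ordinal fxs)) => //.
case: (bP (enum_rank_in fxK (Ordinal fxs))) => Bb fb.
by apply: f_inj; rewrite ?inE // fb enum_rankK_in.
Qed.

Lemma card_range_ord_le (T : Type) (m : nat) (b : 'I_m -> T) :
  range b #<= `I_m.
Proof.
apply: card_le_trans (card_image_le b setT) _.
apply/pcard_leP/injfunPex; exists (@nat_of_ord m); first by move=> i _ /=.
by move=> i j _ _ /val_inj.
Qed.

Section Semiclones.

Variable A : Type.

Lemma proj_preserves_fst (h : ops A) (m : nat) (p : rel_pair A m)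
    (r : 'I_(tag h) -> 'I_m -> A) :
  projections h -> (forall j, rp_fst p (r j)) ->
  rp_fst p (fun i => tagged h (fun j => r j i)).
Proof. by case=> n [i] hE; subst h => rp; exact: rp. Qed.

(** The inner operations need only send rows into the first relation: projections do so trivially,
    members of [Polp Q] because the second relation lies in the first. The outer [f] then lands in
    the second. *)
Lemma semiclone_Polp (Q : set (rel_pairs A)) : semiclone (Polp Q).
Proof.
move=> m n f g Qf Qg p Qp r rp.
apply: (Qf p Qp (fun l i => g l (fun j => r j i))) => l.
case: (Qg l) => [Qgl|]; first exact/rp_sub/(Qgl p Qp).
by move=> /proj_preserves_fst; apply.
Qed.

Lemma semiclone_genP (F : set (ops A)) : semiclone (semiclone_gen F).
Proof.
move=> m n f g Ff Fg M MF.
apply: (MF.1 m n f g (Ff M MF)) => i.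
by case: (Fg i) => [/(_ M MF)|]; [left|right].
Qed.

Lemma semiclone_gen_sub_Polp_Invp (F : set (ops A)) :
  semiclone_gen F `<=` Polp (Invp F).
Proof.
apply: smallest_sub; first exact: semiclone_Polp.
by move=> f Ff p; apply.
Qed.

Section ValuePair.

Variables (G : set (ops A)) (n m : nat) (b : 'I_m -> 'I_n -> A).

Definition value_tuples (H : set (ops A)) : set ('I_m -> A) :=
  [set t | exists2 h : op A n, arity_part H h & t = fun i => h (b i)].

Lemma value_tuplesS : value_tuples G `<=` value_tuples (G `|` @projections A).
Proof. by move=> t [h Gh ->]; exists h => //; left. Qed.

Definition value_pair : rel_pair A m := RelPair value_tuplesS.

Lemma value_pair_Invp : semiclone G -> Invp G (Tagged (rel_pair A) value_pair).
Proof.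
move=> Gclone [k f] Gf r /= rP.
have /choice[h hP] j : exists h : op A n,
    arity_part (G `|` @projections A) h /\ r j = fun i => h (b i).
  by have [h] := rP j; exists h.
(* Each row is the value tuple of some [h j], possibly a projection; the composite is in [G] itself
   because [f] is. *)
exists (comp_op f h); first by apply: Gclone => // j; case: (hP j).
apply/funext => i; rewrite /comp_op; congr f.
by apply/funext => j; case: (hP j) => _ ->.
Qed.

End ValuePair.

End Semiclones.

Theorem theorem5p3 (A : Type) (s : nat) (F : set (ops A)) :
  Polp (Invp_le s F) = sLoc s (semiclone_gen F).
Proof.
apply/seteqP; split=> [[n g] gP B /= /card_le_II_range[m ms [b bB]]|].
  have Fp : Invp_le s F (Tagged (rel_pair A) (value_pair (semiclone_gen F) b)).
    split=> // f Ff; apply: (value_pair_Invp (@semiclone_genP A F)).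
    exact: sub_gen_smallest.
  case: (gP _ Fp (fun j i => b i j)) => [j|h Fh gh].
    by exists (@proj A n j) => //; right; exists n, j.
  exists h => // x; rewrite -bB => -[i _ <-].
  exact: (congr1 (fun t => t i) gh).
move=> [n g] gP [m p] [Fp /= ms] r rp.
(* The columns of the matrix [r] are at most [s] points of $A^n$, so some [f] in the semiclone
   agrees with [g] on all of them. *)
pose b (i : 'I_m) (j : 'I_n) := r j i.
have [|f Ff gf] := gP (range b).
  by apply: card_le_trans (card_range_ord_le b) _; rewrite card_le_II.
have -> : (fun i => g (fun j => r j i)) = (fun i => f (fun j => r j i)).
  by apply/funext => i; apply: (gf (b i)); exists i.
exact: (semiclone_gen_sub_Polp_Invp Ff Fp).
Qed.
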